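(* Let $n,p$ be positive integers, let $(\phi_k)_{k=0}^\infty\subset\mathbb{R}^{p\times n}$ be persistently exciting, let $R\in\mathbb{R}^{n\times n}$ be positive definite, define $P_0=R^{-1}$, let $\lambda\in(0,1]$, and, for all $k\ge 0$, let $P_{k+1}$ be given by $$P_{k+1}=\frac1\lambda P_k-\frac1\lambda P_k\phi_k^{\mathrm T}\left(\lambda I_p+\phi_kP_k\phi_k^{\mathrm T}\right)^{-1}\phi_kP_k .$$ Consider the linear time-varying system on $\mathbb{R}^n$ $$\tilde\theta_{k+1}=(I_n-P_{k+1}\phi_k^{\mathrm T}\phi_k)\tilde\theta_k,\qquad k\ge 0 .$$ Then the zero solution of this system is globally asymptotically stable. Furthermore, if $\lambda\in(0,1)$, then the zero solution of this system is uniformly globally geometrically stable.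
   Context: Matrix inequalities are in the sense of symmetric matrices ($A\le B$ means $B-A$ is positive semidefinite); positive definite matrices are real symmetric; $\|\cdot\|$ is the Euclidean norm. Persistent excitation: a sequence $(\phi_k)_{k=0}^\infty\subset\mathbb{R}^{p\times n}$ is persistently exciting if there exist an integer $N\ge n/p$ and $\alpha,\beta\in(0,\infty)$ such that, for all $j\ge0$, $\alpha I_n\le\sum_{i=j}^{j+N}\phi_i^{\mathrm T}\phi_i\le\beta I_n$. Stability definitions, for a system $x_{k+1}=f(k,x_k)$ with $x_k\in\mathbb{R}^n$, $f$ continuous, and $f(k,0)=0$ for all $k\ge0$: (i) The zero solution is Lyapunov stable if, for all $\varepsilon>0$ and $k_0\ge0$, there exists $\delta(\varepsilon,k_0)>0$ such that, for all $x_{k_0}\in\mathbb{R}^n$ with $\|x_{k_0}\|<\delta(\varepsilon,k_0)$, it holds that $\|x_k\|<\varepsilon$ for all $k\ge k_0$. (ii) The zero solution is globally asymptotically stable if it is Lyapunov stable and, for all $k_0\ge0$ and all $x_{k_0}\in\mathbb{R}^n$, $\lim_{k\to\infty}x_k=0$. (iii) The zero solution is uniformly globally geometrically stable if there exist $a>0$ and $b>1$ such that, for all $k_0\ge0$ and all $x_{k_0}\in\mathbb{R}^n$, it holds that $\|x_k\|\le a\|x_{k_0}\|b^{-(k-k_0)}$ for all $k\ge k_0$. *)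

(* Defs.v *)
From HB Require Import structures.
From mathcomp Require Import all_boot all_order all_algebra.
From mathcomp Require Import all_classical all_reals all_analysis.

Set Implicit Arguments.
Unset Strict Implicit.
Unset Printing Implicit Defensive.

Import Order.TTheory GRing.Theory Num.Theory.
Import numFieldNormedType.Exports.

Local Open Scope classical_set_scope.
Local Open Scope ring_scope.

(* The library norm on matrices is the max norm, hence a separate definition. *)
Definition enorm (K : realType) (n : nat) (x : 'cV[K]_n) : K :=
  Num.sqrt (\sum_(i < n) x i 0 ^+ 2).

Definition psdefmx (K : realType) (n : nat) (A : 'M[K]_n) : Prop :=
  A^T = A /\ forall x : 'cV[K]_n, 0 <= (x^T *m A *m x) 0 0.

Definition posdefmx (K : realType) (n : nat) (A : 'M[K]_n) : Prop :=
  A^T = A /\ forall x : 'cV[K]_n, x != 0 -> 0 < (x^T *m A *m x) 0 0.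

Definition lemx (K : realType) (n : nat) (A B : 'M[K]_n) : Prop :=
  psdefmx (B - A).

Definition persistently_exciting (K : realType) (n p : nat)
    (phi : nat -> 'M[K]_(p, n)) : Prop :=
  exists N : nat, n%:R / p%:R <= N%:R :> K /\
  exists alpha beta : K, [/\ 0 < alpha, 0 < beta &
    forall j : nat,
      let S := \sum_(j <= i < (j + N).+1%N) (phi i)^T *m phi i in
      lemx alpha%:M S /\ lemx S beta%:M].

Record dtsystem (K : realType) (n : nat) := DTSystem {
  dtmap :> nat -> 'cV[K]_n -> 'cV[K]_n;
  dtmap_continuous : forall k, continuous (dtmap k);
  dtmap0 : forall k, dtmap k 0 = 0 }.

(* Only the terms of index at least [k0] matter; the earlier ones are
   unconstrained. *)
Definition solution_from (K : realType) (n : nat) (f : dtsystem K n)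
    (k0 : nat) (x : nat -> 'cV[K]_n) : Prop :=
  forall k, (k0 <= k)%N -> x k.+1 = f k (x k).

Definition lyapunov_stable (K : realType) (n : nat) (f : dtsystem K n) : Prop :=
  forall (eps : K) (k0 : nat), 0 < eps ->
  exists2 delta : K, 0 < delta &
  forall x : nat -> 'cV[K]_n, solution_from f k0 x -> enorm (x k0) < delta ->
  forall k, (k0 <= k)%N -> enorm (x k) < eps.

Definition globally_asymptotically_stable (K : realType) (n : nat)
    (f : dtsystem K n) : Prop :=
  lyapunov_stable f /\
  forall (k0 : nat) (x : nat -> 'cV[K]_n), solution_from f k0 x ->
  x k @[k --> \oo] --> (0 : 'cV[K]_n).

Definition uniformly_globally_geometrically_stable (K : realType) (n : nat)
    (f : dtsystem K n) : Prop :=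
  exists a b : K, [/\ 0 < a, 1 < b &
  forall (k0 : nat) (x : nat -> 'cV[K]_n), solution_from f k0 x ->
  forall k, (k0 <= k)%N -> enorm (x k) <= a * enorm (x k0) * b ^- (k - k0)%N].

Lemma cvg_mx (K : realType) (T : Type) (F : set_system T) (FF : Filter F)
    (m n : nat) (f : T -> 'M[K]_(m, n)) (A : 'M[K]_(m, n)) :
  (forall i j, f x i j @[x --> F] --> A i j) -> f x @[x --> F] --> A.
Proof.
move=> h B [P hP sPB]; rewrite nbhs_simpl /=.
have : \forall x \near F, forall i j, P i j (f x i j).
  apply: filter_forall => i; apply: filter_forall => j.
  exact: (h i j _ (hP i j)).
by apply: filterS => x hx; apply: sPB.
Qed.

Lemma mulmx_cV_continuous (K : realType) (m n : nat) (A : 'M[K]_(m, n)) :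
  continuous (fun x : 'cV[K]_n => A *m x).
Proof.
move=> x; apply: (cvg_mx (nbhs_filter x)) => i j.
rewrite mxE; under eq_fun do rewrite mxE.
apply: cvg_big => [|k _]; first exact: add_continuous.
apply: cvgM; first exact: cvg_cst.
exact: coord_continuous.
Qed.

Definition linear_system (K : realType) (n : nat) (A : nat -> 'M[K]_n) :
    dtsystem K n :=
  @DTSystem K n (fun k x => A k *m x) (fun k => @mulmx_cV_continuous K n n (A k))
    (fun k => mulmx0 _ (A k)).

(* Main.v *)
Require Import Defs.
From mathcomp Require Import all_boot all_order all_algebra.
From mathcomp Require Import all_classical all_reals all_analysis.
From mathcomp Require Import ring lra.

Set Implicit Arguments.
Unset Strict Implicit.
Unset Printing Implicit Defensive.

Import Order.TTheory GRing.Theory Num.Theory.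
Import numFieldNormedType.Exports.

Local Open Scope ring_scope.

(** Write [Q k] for the information matrices defined by [Q 0 = R] and
    [Q k.+1 = lambda *: Q k + (phi k)^T *m phi k].  The recursion for [P] is
    the Woodbury identity in disguise, so [P k] is the inverse of [Q k]
    ([covariance_information]).  Hence
      [1 - P k.+1 *m (phi k)^T *m phi k = lambda *: (P k.+1 *m Q k)],
    and the time-varying system can be solved in closed form
    ([solution_information]):
      [Q k *m x k = lambda ^+ (k - k0) *: (Q k0 *m x k0)].

    Everything now follows from two-sided bounds on the norm of [Q k *m x].
    - From below, the excitation collected over one window keeps the quadratic
      form of [Q k] above a fixed multiple of the identity, even after
      forgetting; the finitely many [Q k] that precede the end of the first
      window are merely invertible, which is enough ([information_coercive]).
      Since [lambda <= 1], the closed form then bounds [x k] by a multiple of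
      [x k0], which is Lyapunov stability.
    - From above, when [lambda < 1] the geometric forgetting dominates the
      bounded increments, so [Q k] is bounded uniformly in [k]
      ([information_bounded]).  Together with the lower bound this gives
      geometric decay at the rate [lambda], with constants that do not depend
      on [k0].
    - When [lambda = 1] nothing is forgotten, and every window adds [alpha]
      to the lower bound ([information_unforgotten_growth]).  As [Q k *m x k]
      is then constant in [k], the state [x k] tends to zero. *)

(** * The Euclidean inner product and norm *)

Definition dot (K : realType) (n : nat) (x y : 'cV[K]_n) : K :=
  (x^T *m y) 0 0.

Lemma dotE (K : realType) (n : nat) (x y : 'cV[K]_n) :
  dot x y = \sum_i x i 0 * y i 0.
Proof. by rewrite /dot mxE; apply: eq_bigr => i _; rewrite mxE. Qed.

Lemma dotC (K : realType) (n : nat) (x y : 'cV[K]_n) : dot x y = dot y x.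
Proof. by rewrite !dotE; apply: eq_bigr => i _; rewrite mulrC. Qed.

Lemma dotDr (K : realType) (n : nat) (x y z : 'cV[K]_n) :
  dot x (y + z) = dot x y + dot x z.
Proof. by rewrite /dot mulmxDr mxE. Qed.

Lemma dotZr (K : realType) (n : nat) (a : K) (x y : 'cV[K]_n) :
  dot x (a *: y) = a * dot x y.
Proof. by rewrite /dot -scalemxAr mxE. Qed.

Lemma dotDl (K : realType) (n : nat) (x y z : 'cV[K]_n) :
  dot (x + y) z = dot x z + dot y z.
Proof. by rewrite dotC dotDr !(dotC z). Qed.

Lemma dotZl (K : realType) (n : nat) (a : K) (x y : 'cV[K]_n) :
  dot (a *: x) y = a * dot x y.
Proof. by rewrite dotC dotZr dotC. Qed.

Lemma dot_tr (K : realType) (m n : nat) (A : 'M[K]_(m, n)) x y :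
  dot x (A^T *m y) = dot (A *m x) y.
Proof. by rewrite /dot trmx_mul mulmxA. Qed.

Lemma enorm_ge0 (K : realType) (n : nat) (x : 'cV[K]_n) : 0 <= enorm x.
Proof. exact: sqrtr_ge0. Qed.

Lemma sqr_enorm (K : realType) (n : nat) (x : 'cV[K]_n) :
  enorm x ^+ 2 = dot x x.
Proof.
rewrite /enorm sqr_sqrtr; last by apply: sumr_ge0 => i _; exact: sqr_ge0.
by rewrite dotE; apply: eq_bigr => i _; rewrite expr2.
Qed.

Lemma dot_ge0 (K : realType) (n : nat) (x : 'cV[K]_n) : 0 <= dot x x.
Proof. by rewrite -sqr_enorm sqr_ge0. Qed.

Lemma coord_le_enorm (K : realType) (n : nat) (x : 'cV[K]_n) i :
  `|x i 0| <= enorm x.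
Proof.
rewrite -(ler_pXn2r (n := 2)) ?nnegrE ?enorm_ge0 // sqr_enorm dotE.
rewrite -normrX ger0_norm ?sqr_ge0 // (bigD1 i) //= -expr2 lerDl.
by apply: sumr_ge0 => j _; rewrite -expr2 sqr_ge0.
Qed.

Lemma enorm_eq0 (K : realType) (n : nat) (x : 'cV[K]_n) :
  enorm x = 0 -> x = 0.
Proof.
move=> x0; apply/colP => i; rewrite mxE; apply/eqP.
by rewrite -normr_le0 -x0 coord_le_enorm.
Qed.

Lemma enorm0 (K : realType) (n : nat) : enorm (0 : 'cV[K]_n) = 0.
Proof.
by apply/eqP; rewrite -sqrf_eq0 sqr_enorm /dot mulmx0 mxE.
Qed.

Lemma enormZ (K : realType) (n : nat) (a : K) (x : 'cV[K]_n) :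
  enorm (a *: x) = `|a| * enorm x.
Proof.
apply/eqP; rewrite -(eqrXn2 (n := 2)) ?mulr_ge0 ?enorm_ge0 //.
by rewrite exprMn !sqr_enorm dotZl dotZr real_normK ?num_real // mulrA -expr2.
Qed.

(** Expanding the square of the norm of [enorm y *: x - enorm x *: y], which is
    nonnegative, gives the bound after division by [2 * enorm x * enorm y]. *)
Lemma cauchy_schwarz (K : realType) (n : nat) (x y : 'cV[K]_n) :
  dot x y <= enorm x * enorm y.
Proof.
have [/eqP/enorm_eq0 ->|x0] := boolP (enorm x == 0).
  by rewrite enorm0 mul0r /dot trmx0 mul0mx mxE.
have [/eqP/enorm_eq0 ->|y0] := boolP (enorm y == 0).
  by rewrite enorm0 mulr0 /dot mulmx0 mxE.
have := enorm_ge0 x; have := enorm_ge0 y.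
have := dot_ge0 (enorm y *: x + (- enorm x) *: y).
rewrite !(dotDl, dotDr, dotZl, dotZr) (dotC y x) -!sqr_enorm.
set a := enorm x in x0 *; set b := enorm y in y0 *; set d := dot x y.
move=> h b0 a0.
have ab : 0 < a * b by rewrite mulr_gt0 // lt_neqAle eq_sym ?x0 ?y0.
by rewrite -subr_ge0 -(pmulr_rge0 _ ab); lra.
Qed.

Lemma enormD (K : realType) (n : nat) (x y : 'cV[K]_n) :
  enorm (x + y) <= enorm x + enorm y.
Proof.
rewrite -(ler_pXn2r (n := 2)) ?nnegrE ?addr_ge0 ?enorm_ge0 //.
rewrite sqrrD !sqr_enorm !(dotDl, dotDr) (dotC y x).
by have := cauchy_schwarz x y; lra.
Qed.

(** Cauchy-Schwarz on each row bounds the operator norm by the Frobenius norm;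
    the constant below exceeds the latter because [s <= (s + 1) ^+ 2]. *)
Lemma mulmx_bounded (K : realType) (m n : nat) (A : 'M[K]_(m, n)) :
  exists2 c : K, 0 < c & forall x, enorm (A *m x) <= c * enorm x.
Proof.
pose s := \sum_(i < m) enorm (row i A)^T ^+ 2.
have s0 : 0 <= s by apply: sumr_ge0 => i _; exact: sqr_ge0.
exists (s + 1) => [|x]; first by lra.
rewrite -(ler_pXn2r (n := 2)) ?nnegrE ?mulr_ge0 ?enorm_ge0 //; last by lra.
rewrite exprMn; apply: (@le_trans _ _ (s * enorm x ^+ 2)); last first.
  by apply: ler_wpM2r; [exact: sqr_ge0 | nra].
rewrite (sqr_enorm (A *m x)) dotE mulr_suml; apply: ler_sum => i _.
have -> : (A *m x) i 0 = dot (row i A)^T x.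
  by rewrite /dot trmxK -row_mul [RHS]mxE.
rewrite -expr2 -exprMn -real_normK ?num_real //.
rewrite ler_pXn2r ?nnegrE ?mulr_ge0 ?enorm_ge0 // ler_norml cauchy_schwarz andbT.
rewrite lerNl; have := cauchy_schwarz ((-1) *: (row i A)^T) x.
by rewrite dotZl enormZ normrN1 mulN1r mul1r.
Qed.

(** * Quadratic forms and operator norms *)

(** A vector in the kernel of [A] annihilates the form, so it is zero. *)
Lemma pos_form_unitmx (K : realType) (n : nat) (A : 'M[K]_n) :
  (forall x : 'cV[K]_n, x != 0 -> 0 < dot x (A *m x)) -> A \in unitmx.
Proof.
move=> Apos; rewrite -unitmx_tr -row_free_unit -kermx_eq0.
apply/eqP/row_matrixP => i; rewrite row0; apply/eqP/negPn/negP => u0.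
have uA : row i (kermx A^T) *m A^T = 0.
  by apply/sub_kermxP; exact: row_sub.
have := Apos (row i (kermx A^T))^T; rewrite trmx_eq0 => /(_ u0).
by rewrite -{2}(trmxK A) -trmx_mul uA trmx0 /dot mulmx0 mxE ltxx.
Qed.

Lemma posdefmx_energy_ge0 (K : realType) (n : nat) (A : 'M[K]_n) :
  posdefmx A -> forall x, 0 <= dot x (A *m x).
Proof.
move=> [_ Apos] x; have [->|/Apos/ltW] := eqVneq x 0.
  by rewrite mulmx0 /dot mulmx0 mxE.
by rewrite /dot mulmxA.
Qed.

(** Cauchy-Schwarz bounds the form by [enorm x * enorm (A *m x)]; cancel
    [enorm x]. *)
Lemma coercive_enorm (K : realType) (n : nat) (c : K) (A : 'M[K]_n) x :
  c * enorm x ^+ 2 <= dot x (A *m x) -> c * enorm x <= enorm (A *m x).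
Proof.
move=> h; have [/eqP x0|x0] := boolP (enorm x == 0).
  by rewrite x0 mulr0 enorm_ge0.
have xp : 0 < enorm x by rewrite lt_neqAle eq_sym x0 enorm_ge0.
rewrite -(ler_pM2r xp); apply: (le_trans _ (le_trans h _)).
  by rewrite expr2 mulrA.
by rewrite mulrC cauchy_schwarz.
Qed.

(** With [y = A^T *m A *m x], the square of [enorm y] is [dot (A *m y) (A *m x)],
    which is at most [b * enorm y * enorm x]. *)
Lemma gram_bounded (K : realType) (m n : nat) (b : K) (A : 'M[K]_(m, n)) :
  (forall x, enorm (A *m x) ^+ 2 <= b * enorm x ^+ 2) -> 0 <= b ->
  forall x, enorm (A^T *m A *m x) <= b * enorm x.
Proof.
move=> h b0 x; set y := A^T *m A *m x.
have [/eqP y0|y0] := boolP (enorm y == 0).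
  by rewrite y0 mulr_ge0 ?enorm_ge0.
have yp : 0 < enorm y by rewrite lt_neqAle eq_sym y0 enorm_ge0.
rewrite -(ler_pM2r yp) -expr2 sqr_enorm {2}/y -mulmxA dot_tr.
apply: (le_trans (cauchy_schwarz _ _)).
rewrite -(ler_pXn2r (n := 2)) ?nnegrE ?mulr_ge0 ?enorm_ge0 //.
have := ler_pM (sqr_ge0 _) (sqr_ge0 _) (h y) (h x).
by rewrite !exprMn expr2; lra.
Qed.

(** * Information matrices *)

(** The inverse of the covariance matrix of recursive least squares with
    forgetting factor [lambda]: unlike the covariance, it obeys an affine
    recursion. *)
Fixpoint information (K : realType) (n p : nat) (phi : nat -> 'M[K]_(p, n))
    (lambda : K) (R : 'M[K]_n) (k : nat) : 'M[K]_n :=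
  if k is k'.+1 then
    lambda *: information phi lambda R k' + (phi k')^T *m phi k'
  else R.

(** Put [S = l%:M + phi *m P *m phi^T].  When the product is expanded, the
    quadratic term contains [phi *m P *m phi^T = S - l%:M]; its part in [S]
    cancels the linear term, and its part in [l%:M] cancels the rest. *)
Lemma woodbury (K : realType) (n p : nat) (phi : 'M[K]_(p, n))
    (l : K) (P Q : 'M[K]_n) :
  l != 0 -> l%:M + phi *m P *m phi^T \in unitmx -> P *m Q = 1%:M ->
  (l^-1 *: P - l^-1 *:
     (P *m phi^T *m invmx (l%:M + phi *m P *m phi^T) *m phi *m P))
    *m (l *: Q + phi^T *m phi) = 1%:M.
Proof.
move=> l0 Su PQ; set S := l%:M + _ in Su *.
set W := P *m phi^T *m invmx S *m phi.
have WP : W *m P *m phi^T *m phi = P *m phi^T *m phi - l *: W.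
  have -> : W *m P *m phi^T *m phi
      = P *m phi^T *m (invmx S *m (phi *m P *m phi^T)) *m phi.
    by rewrite /W !mulmxA.
  have -> : phi *m P *m phi^T = S - l%:M by rewrite /S addrC addKr.
  rewrite mulmxBr mulVmx // mul_mx_scalar mulmxBr mulmx1 mulmxBl.
  by rewrite -scalemxAr -scalemxAl.
rewrite mulmxBl !mulmxDr -!scalemxAl -!scalemxAr !scalerA mulVf // !scale1r.
rewrite PQ -(mulmxA W) PQ mulmx1 (mulmxA (W *m P)) WP mulmxA.
rewrite scalerBr scalerA mulVf // scale1r.
by rewrite [W + _]addrC subrK addrK.
Qed.

Lemma information_energyS (K : realType) (n p : nat)
    (phi : nat -> 'M[K]_(p, n)) (l : K) (R : 'M[K]_n) k x :
  dot x (information phi l R k.+1 *m x) =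
  l * dot x (information phi l R k *m x) + enorm (phi k *m x) ^+ 2.
Proof.
by rewrite /= mulmxDl dotDr -scalemxAl dotZr -mulmxA dot_tr -sqr_enorm.
Qed.

Lemma information_energy_ge0 (K : realType) (n p : nat)
    (phi : nat -> 'M[K]_(p, n)) (l : K) (R : 'M[K]_n) :
  0 <= l -> (forall x, 0 <= dot x (R *m x)) ->
  forall k x, 0 <= dot x (information phi l R k *m x).
Proof.
move=> l0 R0; elim=> [//|k IH] x.
by rewrite information_energyS addr_ge0 ?sqr_ge0 // mulr_ge0.
Qed.

(** Over [m] steps, the initial form and each of the increments are discounted
    at most [m] times. *)
Lemma information_window (K : realType) (n p : nat)
    (phi : nat -> 'M[K]_(p, n)) (l : K) (R : 'M[K]_n) k m x :
  0 < l <= 1 ->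
  l ^+ m * (dot x (information phi l R k *m x)
            + \sum_(k <= i < k + m) enorm (phi i *m x) ^+ 2)
  <= dot x (information phi l R (k + m) *m x).
Proof.
move=> /andP[l0 l1]; elim: m => [|m IH].
  by rewrite addn0 big_geq // addr0 expr0 mul1r.
rewrite addnS information_energyS big_nat_recr ?leq_addr //= addrA mulrDr.
apply: lerD; first by rewrite exprS -mulrA ler_pM2l.
by rewrite ler_piMl ?sqr_ge0 // exprn_ile1 // ltW.
Qed.

Lemma lemx_scalar_energy (K : realType) (n p : nat) (c : K)
    (phi : nat -> 'M[K]_(p, n)) (i j : nat) (x : 'cV[K]_n) :
  let S := \sum_(i <= k < j) (phi k)^T *m phi k in
  (lemx c%:M S ->
    c * enorm x ^+ 2 <= \sum_(i <= k < j) enorm (phi k *m x) ^+ 2) /\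
  (lemx S c%:M ->
    \sum_(i <= k < j) enorm (phi k *m x) ^+ 2 <= c * enorm x ^+ 2).
Proof.
move=> S.
have Sx : dot x (S *m x) = \sum_(i <= k < j) enorm (phi k *m x) ^+ 2.
  rewrite /S mulmx_suml /dot mulmx_sumr summxE; apply: eq_bigr => k _.
  by rewrite -mulmxA -/(dot _ _) dot_tr sqr_enorm.
have cx : dot x (c%:M *m x) = c * enorm x ^+ 2.
  by rewrite mul_scalar_mx dotZr sqr_enorm.
split=> -[_ /(_ x)]; rewrite -mulmxA -/(dot _ _) mulmxBl dotDr -scaleN1r.
  by rewrite dotZr Sx cx mulN1r subr_ge0.
by rewrite dotZr Sx cx mulN1r subr_ge0.
Qed.

(** The upper matrix inequality bounds each term of a window separately, since
    the other terms are positive semidefinite. *)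
Lemma persistently_exciting_energy (K : realType) (n p : nat)
    (phi : nat -> 'M[K]_(p, n)) :
  persistently_exciting phi ->
  exists N : nat, exists alpha beta : K, [/\ 0 < alpha, 0 < beta,
    forall j x, alpha * enorm x ^+ 2 <=
      \sum_(j <= i < j + N.+1) enorm (phi i *m x) ^+ 2 &
    forall j x, enorm (phi j *m x) ^+ 2 <= beta * enorm x ^+ 2].
Proof.
move=> [N [_ [a [b [a0 b0 h]]]]]; exists N, a, b; split => // j x.
  by have [+ _] := h j; rewrite -addnS; exact: (lemx_scalar_energy _ _ _ _ _).1.
have [_ /((lemx_scalar_energy _ _ _ _ x).2)] := h j.
rewrite big_ltn ?ltnS ?leq_addr //; apply: le_trans.
by rewrite lerDl; apply: sumr_ge0 => i _; exact: sqr_ge0.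
Qed.

(** The number [b / (1 - l)] is the fixed point of [C |-> l * C + b], the map
    through which one step of the recursion acts on a bound.  The bound of [R]
    is added so that the estimate holds at time 0. *)
Lemma information_bounded (K : realType) (n p : nat)
    (phi : nat -> 'M[K]_(p, n)) (l b : K) (R : 'M[K]_n) :
  0 < l < 1 -> 0 < b ->
  (forall j x, enorm (phi j *m x) ^+ 2 <= b * enorm x ^+ 2) ->
  exists2 C : K, 0 < C &
    forall k x, enorm (information phi l R k *m x) <= C * enorm x.
Proof.
move=> /andP[l0 l1] b0 hb; have [c c0 Rc] := mulmx_bounded R.
exists (c + b / (1 - l)) => [|k].
  by rewrite addr_gt0 // divr_gt0 // subr_gt0.
have fb : b = (1 - l) * (b / (1 - l)) by field; rewrite subr_eq0 gt_eqF.
have f0 : 0 < b / (1 - l) by rewrite divr_gt0 // subr_gt0.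
elim: k => [|k IH] x.
  apply: (le_trans (Rc x)); apply: ler_wpM2r; first exact: enorm_ge0.
  by rewrite lerDl ltW.
rewrite /= mulmxDl; apply: (le_trans (enormD _ _)).
rewrite -scalemxAl enormZ gtr0_norm //.
have := gram_bounded (hb k) (ltW b0) x; rewrite [X in _ <= X * _]fb.
have := ler_wpM2l (ltW l0) (IH x).
have : l * (c * enorm x) <= c * enorm x.
  by rewrite ler_piMl ?mulr_ge0 ?enorm_ge0 ?ltW.
by set f := b / _; lra.
Qed.

(** Past time [N], the last complete window alone gives the constant
    [l ^+ N.+1 * a].  The finitely many earlier matrices are invertible, and
    the bound of the inverse gives a constant for each of them. *)
Lemma information_coercive (K : realType) (n p : nat)
    (phi : nat -> 'M[K]_(p, n)) (l a : K) (R : 'M[K]_n) (N : nat) :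
  0 < l <= 1 -> 0 < a -> (forall x, 0 <= dot x (R *m x)) ->
  (forall j x, a * enorm x ^+ 2 <=
      \sum_(j <= i < j + N.+1) enorm (phi i *m x) ^+ 2) ->
  (forall k, information phi l R k \in unitmx) ->
  exists2 c : K, 0 < c &
    forall k x, c * enorm x <= enorm (information phi l R k *m x).
Proof.
move=> l01 a0 R0 ha Qu; have /andP[l0 l1] := l01.
have early M : exists2 c : K, 0 < c &
    forall k x, (k < M)%N -> c * enorm x <= enorm (information phi l R k *m x).
  elim: M => [|M [c c0 hc]]; first by exists 1.
  have [d d0 hd] := mulmx_bounded (invmx (information phi l R M)).
  exists (Num.min c d^-1) => [|k x]; first by rewrite lt_min c0 invr_gt0.
  rewrite ltnS leq_eqVlt => /orP[/eqP ->|kM].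
    apply: (@le_trans _ _ (d^-1 * enorm x)).
      by rewrite ler_wpM2r ?enorm_ge0 // ge_min lexx orbT.
    rewrite ler_pdivrMl //.
    by have := hd (information phi l R M *m x); rewrite mulmxA mulVmx // mul1mx.
  apply: le_trans (hc k x kM).
  by rewrite ler_wpM2r ?enorm_ge0 // ge_min lexx.
have [c c0 hc] := early N.+1.
exists (Num.min c (l ^+ N.+1 * a)) => [|k x].
  by rewrite lt_min c0 mulr_gt0 // exprn_gt0.
have [kN|Nk] := ltnP k N.+1.
  apply: le_trans (hc k x kN).
  by rewrite ler_wpM2r ?enorm_ge0 // ge_min lexx.
apply: (@le_trans _ _ (l ^+ N.+1 * a * enorm x)).
  by rewrite ler_wpM2r ?enorm_ge0 // ge_min lexx orbT.
apply: coercive_enorm; rewrite -(subnK Nk).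
have q0 := information_energy_ge0 phi (ltW l0) R0 (k - N.+1) x.
apply: le_trans (information_window _ _ _ _ _ l01).
rewrite -mulrA ler_wpM2l ?exprn_ge0 ?(ltW l0) //.
by apply: (le_trans (ha (k - N.+1)%N x)); rewrite lerDr.
Qed.

(** With forgetting factor 1, the [m] consecutive windows starting at the multiples
    of [N.+1] add up without discount. *)
Lemma information_unforgotten_growth (K : realType) (n p : nat)
    (phi : nat -> 'M[K]_(p, n)) (a : K) (R : 'M[K]_n) (N : nat) :
  (forall x, 0 <= dot x (R *m x)) ->
  (forall j x, a * enorm x ^+ 2 <=
      \sum_(j <= i < j + N.+1) enorm (phi i *m x) ^+ 2) ->
  forall m k x, (m * N.+1 <= k)%N ->
    (m%:R * a) * enorm x <= enorm (information phi 1 R k *m x).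
Proof.
move=> R0 ha m k x mk; apply: coercive_enorm.
have mono j i : dot x (information phi 1 R j *m x)
    + \sum_(j <= k < j + i) enorm (phi k *m x) ^+ 2
    <= dot x (information phi 1 R (j + i) *m x).
  have := @information_window _ _ _ phi 1 R j i x.
  by rewrite expr1n mul1r ltr01 lexx; exact.
rewrite -(subnKC mk); apply: (le_trans _ (mono _ _)).
apply: (@le_trans _ _ (dot x (information phi 1 R (m * N.+1) *m x))).
  elim: m {mk} => [|m IH]; first by rewrite !mul0r information_energy_ge0.
  rewrite mulSnr; apply: (le_trans _ (mono _ _)).
  by rewrite -natr1 2!mulrDl mul1r; exact: lerD.
by rewrite lerDl; apply: sumr_ge0 => i _; exact: sqr_ge0.
Qed.

(** * The recursive least squares error system *)

(** The innovation matrix is invertible because [P k], as the inverse of a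
    positive semidefinite matrix, is itself positive semidefinite. *)
Lemma covariance_information (K : realType) (n p : nat)
    (phi : nat -> 'M[K]_(p, n)) (R : 'M[K]_n) (l : K) (P : nat -> 'M[K]_n) :
  posdefmx R -> 0 < l -> P 0%N = invmx R ->
  (forall k : nat,
      P k.+1 = l^-1 *: P k - l^-1 *:
        (P k *m (phi k)^T *m invmx (l%:M + phi k *m P k *m (phi k)^T)
           *m phi k *m P k)) ->
  forall k, P k *m information phi l R k = 1%:M.
Proof.
move=> Rpos l0 P0 PS; elim=> [|k IH].
  rewrite P0 mulVmx //; apply: pos_form_unitmx => x x0.
  by rewrite /dot mulmxA Rpos.2.
rewrite PS /=; apply: woodbury => //; first by rewrite gt_eqF.
apply: pos_form_unitmx => y y0.
rewrite mulmxDl dotDr mul_scalar_mx dotZr.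
have yy : 0 < dot y y.
  rewrite -sqr_enorm exprn_gt0 // lt_neqAle enorm_ge0 andbT eq_sym.
  by apply: contra_neq y0; exact: enorm_eq0.
apply: ltr_wpDr; last by rewrite mulr_gt0.
rewrite -!mulmxA -{1}(trmxK (phi k)) dot_tr.
set z := (phi k)^T *m y.
(* The form of [P k] at [z] is the form of the information matrix at
   [P k *m z]. *)
have -> : z = information phi l R k *m (P k *m z).
  by rewrite mulmxA (mulmx1C IH) mul1mx.
rewrite (mulmxA (P k)) IH mul1mx dotC information_energy_ge0 ?ltW //.
exact: posdefmx_energy_ge0.
Qed.

(** Multiplying the system by the information matrix at time [k.+1] turns the
    factor [1 - P k.+1 *m (phi k)^T *m phi k] into [l] times the information
    matrix at time [k]: the added Gram matrix cancels. *)
Lemma solution_information (K : realType) (n p : nat)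
    (phi : nat -> 'M[K]_(p, n)) (R : 'M[K]_n) (l : K) (P : nat -> 'M[K]_n)
    (k0 : nat) (x : nat -> 'cV[K]_n) :
  (forall k, P k *m information phi l R k = 1%:M) ->
  solution_from
    (linear_system (fun k => 1%:M - P k.+1 *m (phi k)^T *m phi k)) k0 x ->
  forall k, (k0 <= k)%N ->
    information phi l R k *m x k =
    l ^+ (k - k0) *: (information phi l R k0 *m x k0).
Proof.
move=> PQ xS k k0k; rewrite -{1 2}(subnKC k0k).
elim: (k - k0)%N => [|m IH]; first by rewrite addn0 expr0 scale1r.
rewrite addnS xS ?leq_addr //= -/(information phi l R (k0 + m).+1).
have QP := mulmx1C (PQ (k0 + m).+1).
rewrite [X in X *m _]/= in QP.
rewrite mulmxA mulmxBr mulmx1 -(mulmxA (P _)) (mulmxA _ (P _)) QP mul1mx addrK.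
by rewrite -scalemxAl IH scalerA exprS.
Qed.

Lemma enorm_cvg0 (K : realType) (n : nat) (x : nat -> 'cV[K]_n) :
  (forall eps : K, 0 < eps ->
    exists M, forall k, (M <= k)%N -> enorm (x k) < eps) ->
  (x k @[k --> \oo] --> (0 : 'cV[K]_n))%classic.
Proof.
move=> h; apply: cvg_mx => i j; rewrite mxE ord1.
apply/cvgrPdist_lt => e /h[M hM]; exists M => // k /= /hM.
by rewrite sub0r normrN; apply: le_lt_trans; exact: coord_le_enorm.
Qed.

Theorem theorem7 (K : realType) (n p : nat) (hn : (0 < n)%N) (hp : (0 < p)%N)
    (phi : nat -> 'M[K]_(p, n)) (hphi : persistently_exciting phi)
    (R : 'M[K]_n) (hR : posdefmx R)
    (lambda : K) (hlambda : 0 < lambda <= 1)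
    (P : nat -> 'M[K]_n) (hP0 : P 0%N = invmx R)
    (hP : forall k : nat,
      P k.+1 = lambda^-1 *: P k - lambda^-1 *:
        (P k *m (phi k)^T *m invmx (lambda%:M + phi k *m P k *m (phi k)^T)
           *m phi k *m P k)) :
  let theta_system :=
    linear_system (fun k => 1%:M - P k.+1 *m (phi k)^T *m phi k) in
  globally_asymptotically_stable theta_system /\
  (lambda < 1 -> uniformly_globally_geometrically_stable theta_system).
Proof.
move=> sys; have /andP[l0 l1] := hlambda.
have [N [a [b [a0 b0 ha hb]]]] := persistently_exciting_energy hphi.
have PQ := covariance_information hR l0 hP0 hP.
have R0 := posdefmx_energy_ge0 hR.
have Qu k : information phi lambda R k \in unitmx by have [] := mulmx1_unit (PQ k).
have [c c0 hc] := information_coercive hlambda a0 R0 ha Qu.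
have xQ k0 x : solution_from sys k0 x -> forall k, (k0 <= k)%N ->
    enorm (information phi lambda R k *m x k) =
    lambda ^+ (k - k0) * enorm (information phi lambda R k0 *m x k0).
  move=> /(solution_information PQ) h k /h ->.
  by rewrite enormZ ger0_norm // exprn_ge0 // ltW.
have geom : lambda < 1 -> uniformly_globally_geometrically_stable sys.
  move=> ll1; have l01 : 0 < lambda < 1 by rewrite l0.
  have [C C0 hC] := information_bounded R l01 b0 hb.
  exists (C / c), lambda^-1; split; [exact: divr_gt0|by rewrite invf_gt1|].
  move=> k0 x /xQ xS k /xS xk.
  rewrite exprVn invrK -(ler_pM2l c0); apply: (le_trans (hc k _)); rewrite xk.
  have -> : c * (C / c * enorm (x k0) * lambda ^+ (k - k0)) =
      lambda ^+ (k - k0) * (C * enorm (x k0)) by field; rewrite gt_eqF.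
  by rewrite ler_wpM2l // exprn_ge0 // ltW.
split=> //; split.
  move=> eps k0 eps0; have [B B0 hB] := mulmx_bounded (information phi lambda R k0).
  exists (c * eps / B) => [|x /xQ xS x0 k /xS xk].
    by rewrite divr_gt0 ?mulr_gt0.
  rewrite -(ltr_pM2l c0); apply: (le_lt_trans (hc k _)); rewrite xk.
  apply: (@le_lt_trans _ _ (B * enorm (x k0))).
    apply: le_trans (hB _); rewrite ler_piMl ?enorm_ge0 //.
    by rewrite exprn_ile1 // ltW.
  by rewrite mulrC -ltr_pdivlMr.
move=> k0 x xS; apply: enorm_cvg0 => eps eps0.
move: l1; rewrite le_eqVlt => /orP[/eqP l1|ll1].
  set D := enorm (information phi lambda R k0 *m x k0).
  have [m hm] : exists m : nat, D / (a * eps) < m%:R.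
    by exists (Num.truncn (D / (a * eps))).+1; rewrite truncnS_gt.
  exists (maxn k0 (m * N.+1)) => k; rewrite geq_max => /andP[k0k mk].
  have := information_unforgotten_growth R0 ha (x k) mk.
  have := xQ _ _ xS k k0k; rewrite -/D l1 expr1n mul1r => ->.
  move: hm; rewrite ltr_pdivrMr ?mulr_gt0 // mulrA => hm /le_lt_trans/(_ hm).
  rewrite ltr_pM2l // mulr_gt0 // lt_neqAle ler0n andbT eq_sym pnatr_eq0.
  apply/eqP => m0; move: hm; rewrite m0 !mul0r ltNge => /negP; apply.
  exact: enorm_ge0.
set D := enorm (information phi lambda R k0 *m x k0).
have lim : (geometric D lambda @ \oo --> (0 : K))%classic.
  by apply: cvg_geometric; rewrite gtr0_norm.
have ce : 0 < c * eps by rewrite mulr_gt0.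
move/cvgrPdist_lt: lim => /(_ _ ce)[M _ hM].
exists (k0 + M)%N => k kM; have k0k := leq_trans (leq_addr M k0) kM.
rewrite -(ltr_pM2l c0); apply: (le_lt_trans (hc k _)).
rewrite (xQ _ _ xS k k0k) -/D mulrC; apply: le_lt_trans (hM (k - k0)%N _).
  by rewrite sub0r normrN /geometric /= ler_norm.
by rewrite /= leq_subRL.
Qed.
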